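(* Let $G$ be a (finite, simple) $8$-regular graph. Then $G$ admits a balanced path tracking decomposition $\mathcal{B}$ in which every element is a $4$-tracking (that is, a balanced $4$-tracking decomposition all of whose elements induce paths).
   Context: Graphs are finite and simple. A tracking of length $\ell$ (an $\ell$-tracking) in $G$ is a sequence $B=x_0x_1\cdots x_\ell$ of vertices of $G$ such that $x_ix_{i+1}\in E(G)$ for $0\le i\le \ell-1$ and the edges $x_ix_{i+1}$ are pairwise distinct; its edge set is $E(B)=\{x_ix_{i+1}: 0\le i\le \ell-1\}$, and the trail it induces is the graph $(\{x_0,\dots,x_\ell\},E(B))$. A tracking and its reverse $x_\ell\cdots x_0$ are not distinguished. The tracking induces a path if its vertices $x_0,\dots,x_\ell$ are pairwise distinct. A tracking decomposition of $G$ is a set $\mathcal{B}$ of pairwise edge-disjoint trackings with $\bigcup_{B\in\mathcal{B}}E(B)=E(G)$; it is an $\ell$-tracking decomposition if all its elements have length $\ell$, and a path tracking decomposition if all its elements induce paths. If all elements of $\mathcal{B}$ have length at least $2$, orient, for each $B=x_0\cdots x_\ell\in\mathcal{B}$, the edge $x_0x_1$ from $x_1$ to $x_0$ and the edge $x_{\ell-1}x_\ell$ from $x_{\ell-1}$ to $x_\ell$; $\mathcal{B}(v)$ denotes the number of these oriented edges directed towards $v$. The decomposition $\mathcal{B}$ is balanced if $\mathcal{B}(u)=\mathcal{B}(v)$ for all $u,v\in V(G)$. *)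

(* Defs.v *)
From mathcomp Require Import all_boot.
Set Implicit Arguments.
Unset Strict Implicit.
Unset Printing Implicit Defensive.

(* A finite simple graph is a symmetric irreflexive relation e on a finType,
   and its edges are the two-element sets [set x; y] with e x y. *)
Definition simple_graph (T : finType) (e : rel T) : Prop :=
  symmetric e /\ irreflexive e.

Definition regular (T : finType) (e : rel T) (k : nat) : Prop :=
  forall v : T, #|[set w | e v w]| = k.

Definition graph_edges (T : finType) (e : rel T) : {set {set T}} :=
  [set [set p.1; p.2] | p : T * T & e p.1 p.2].

Section Tracking.

Variable T : finType.
Implicit Types (e : rel T) (s t : seq T) (B : seq (seq T)) (v : T).

(* The edges x_0 x_1, ..., x_(l-1) x_l of x_0 ... x_l, in order and with
   repetitions. *)
Definition edge_seq s : seq {set T} :=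
  if s is x :: p then pairmap (fun y z => [set y; z]) x p else [::].

Definition edge_set s : {set {set T}} := [set f in edge_seq s].

(* A tracking x_0 ... x_l is stored as its list of l + 1 vertices; the empty
   list is not a tracking. *)
Definition is_tracking e s : bool :=
  if s is x :: p then path e x p && uniq (edge_seq s) else false.

Definition tracking_length s : nat := (size s).-1.

Definition induces_path s : bool := uniq s.

Definition same_tracking s t : bool := (s == t) || (s == rev t).

(* A set of trackings, where a tracking and its reverse are identified, is
   represented by a list containing exactly one representative of each. *)
Definition tracking_decomposition e B : Prop :=
  [/\ all (is_tracking e) B,
      pairwise (fun s t => ~~ same_tracking s t) B,
      pairwise (fun s t => [disjoint edge_set s & edge_set t]) B
    & \bigcup_(s <- B) edge_set s = graph_edges e].

Definition l_tracking_decomposition e (l : nat) B : Prop :=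
  tracking_decomposition e B /\ all (fun s => tracking_length s == l) B.

Definition path_tracking_decomposition e B : Prop :=
  tracking_decomposition e B /\ all induces_path B.

(* For s = x_0 ... x_l, the arcs (x_1, x_0) and (x_(l-1), x_l), each written
   as (tail, head). *)
Definition end_arcs s : seq (T * T) :=
  if s is x :: y :: p
  then [:: (y, x); (last x (belast y p), last y p)]
  else [::].

(* The number B(v); the arcs it counts are pairwise distinct as soon as B is a
   decomposition into trackings of length at least 2. *)
Definition arcs_towards B v : nat :=
  count (fun a : T * T => a.2 == v) (flatten [seq end_arcs s | s <- B]).

Definition balanced B : Prop :=
  all (fun s => 2 <= tracking_length s) B /\
  forall u v : T, arcs_towards B u = arcs_towards B v.

(* None of these notions depends on the chosen representative. *)
Lemma edge_seq_rev s : edge_seq (rev s) = rev (edge_seq s).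
Proof.
have edge_seq_rcons q y x :
    edge_seq (rcons (rcons q y) x) = rcons (edge_seq (rcons q y)) [set y; x].
  by case: q => [|z q] //=; rewrite -cats1 pairmap_cat last_rcons cats1.
elim: s => [|x [|y p] IH] //.
have -> : edge_seq (x :: y :: p) = [set x; y] :: edge_seq (y :: p) by [].
by rewrite !rev_cons edge_seq_rcons -[rcons _ y]rev_cons IH [in LHS]setUC.
Qed.

Lemma is_tracking_rev e s : symmetric e -> is_tracking e (rev s) = is_tracking e s.
Proof.
move=> esym; case: s => [|x p] //.
have E : is_tracking e (rev (x :: p)) =
    sorted e (rev (x :: p)) && uniq (edge_seq (rev (x :: p))).
  by rewrite lastI rev_rcons.
rewrite E edge_seq_rev rev_uniq rev_sorted /=; congr (_ && _).
by apply: eq_path => y z; rewrite esym.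
Qed.

Lemma arcs_towards_rev s v : arcs_towards [:: rev s] v = arcs_towards [:: s] v.
Proof.
have arcsE x y p : end_arcs (rev (x :: y :: p)) = rev (end_arcs (x :: y :: p)).
  case/lastP: p => [|p z] //; rewrite !rev_cons rev_rcons /=.
  case: (lastP p) => [|q w]; first by [].
  by rewrite rev_rcons /= !belast_rcons !last_rcons /= !last_rcons.
rewrite /arcs_towards /= !cats0; case: s => [|x [|y p]] //.
by rewrite arcsE count_rev.
Qed.

End Tracking.

(* Main.v *)
Require Import Defs.
From mathcomp Require Import all_boot zify.
Set Implicit Arguments.
Unset Strict Implicit.
Unset Printing Implicit Defensive.

(** Orient [e] with all in- and out-degrees 4, and split the arcs into a part
    [h] and its complement, each with in- and out-degrees 2.  For a centre [b]
    with [h]-successors [v] and [w], the path [v b w] is to be extended by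
    edges leaving [v] and [w] in the complement [F] of [h]; every vertex then
    has two such edges and is an inner end of two such paths, so the only
    freedom is a binary choice at each vertex, and each centre imposes a
    constraint on the choices at [v] and [w].  The constraints thus form cycles,
    those of the permutation [s] sending [v] to [w].

    Two preparations make this cyclic 2-SAT instance solvable.  First, [h] can
    be chosen without two centres having the same pair of successors, so that
    the cycles of [s] have length at least 3.  Second, [F] can be reoriented so
    that [s u] and [s (s u)], when both are [F]-neighbours of [u], are never both
    successors or both predecessors of [u].  Since [F] has in-degree 2,
    propagation of forced choices then stops after one step without conflict. *)

(** * Pairings, alternating colourings and even splittings *)

Definition pairing (T : finType) (f : T -> T) (N : {set T}) :=
  {in N, forall x, [/\ f x \in N, f (f x) = x & f x != x]}.

(* The orbits of [x] and [f x] under [g \o f] are distinct, and [g] and [f]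
   both exchange them; colour by comparing their representatives. *)
Lemma pairing_coloring (T : finType) (P : {set T}) (f g : T -> T) :
  pairing f P -> pairing g P ->
  exists c : T -> bool, {in P, forall x, c (f x) = ~~ c x /\ c (g x) = ~~ c x}.
Proof.
move=> fP gP.
pose f' x := if x \in P then f x else x; pose g' x := if x \in P then g x else x.
have fK : involutive f'.
  by move=> x; rewrite /f'; case xP: (x \in P); [have [-> -> _] := fP x xP | rewrite xP].
have gK : involutive g'.
  by move=> x; rewrite /g'; case xP: (x \in P); [have [-> -> _] := gP x xP | rewrite xP].
pose k x := g' (f' x).
have kI : injective k by apply: inj_comp; apply: inv_inj.
have iterI n : injective (iter n k).
  by elim: n => [|n IH] x y //= /kI /IH.
(* [f'] conjugates [k] to its inverse; [fkn] extends this to the powers of [k]. *)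
have fk x : f' (k (f' (k x))) = x by rewrite /k [f' (f' (g' _))]fK gK fK.
have fkn n x : f' (iter n k (f' (iter n k x))) = x.
  elim: n x => [|n IH] x; first exact: fK.
  rewrite iterSr [iter n.+1 k x]iterS.
  have -> : k (f' (k (iter n k x))) = f' (iter n k x) by rewrite -[LHS]fK fk.
  exact: IH.
have fkn' n x : iter n k (f' (iter n k x)) = f' x by rewrite -[LHS]fK fkn.
(* If [iter n k x] were [f' x], the middle point [y] of this stretch of the orbit would satisfy
   [y = f' y] for even [n] and [k y = f' y] for odd [n]; the latter makes [f' y] a fixed point of
   [g']. *)
have sep x : x \in P -> ~~ fconnect k x (f' x).
  move=> xP; apply/negP => /iter_findex; move: (findex _ _ _) => n def_n.
  have inP y m : y \in P -> iter m k y \in P.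
    move=> yP; elim: m => [|m IH] //=; rewrite /k /f' IH.
    by have [fyP _ _] := fP _ IH; rewrite /g' fyP; case: (gP _ fyP).
  have := odd_double_half n; case: (odd n) => /= En; rewrite -En in def_n.
    have yP := inP x n./2 xP; set y := iter _ k x in yP.
    have Ey : k y = f' y.
      apply: (iterI n./2); rewrite fkn' -def_n.
      by rewrite /y -iterSr -!iterD addSn addnn.
    move: Ey; rewrite /k /f' yP; have [fyP _ _] := fP _ yP.
    by rewrite /g' fyP; have [_ _ /eqP] := gP _ fyP.
  have yP := inP x n./2 xP; set y := iter _ k x in yP.
  have Ey : y = f' y.
    apply: (iterI n./2); rewrite fkn' -def_n.
    by rewrite /y -iterD addnn.
  by move: (esym Ey); rewrite /f' yP; have [_ _ /eqP] := fP _ yP.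
have rootk x : froot k (k x) = froot k x.
  by apply/esym/(rootP (fconnect_sym kI)); apply: fconnect1.
pose c x := enum_rank (froot k x) < enum_rank (froot k (f' x)).
have cf x : x \in P -> c (f' x) = ~~ c x.
  move=> xP; rewrite /c fK -leqNgt ltn_neqAle.
  rewrite (inj_eq val_inj) (inj_eq enum_rank_inj) eq_sym.
  by rewrite root_connect ?(sep x) //; apply: fconnect_sym.
exists c => x xP; split; first by rewrite -cf // /f' xP.
have -> : g x = k (f' x) by rewrite /k fK /g' xP.
rewrite -cf // /c rootk fK; congr (_ < enum_rank _).
by rewrite -(rootk (f' _)) /k fK gK fK.
Qed.

Lemma even_pairing (T : finType) (N : {set T}) :
  ~~ odd #|N| -> exists f, pairing f N.
Proof.
have [n] := ubnP #|N|; elim: n N => // n IH N ltNn evN.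
have [->|[x xN]] := set_0Vmem N; first by exists id => x; rewrite inE.
have [N1|[y yN]] := set_0Vmem (N :\ x).
  by move: evN; rewrite (cardsD1 x) xN N1 cards0.
have cN : #|N| = #|N :\ x :\ y|.+2.
  by rewrite (cardsD1 x) xN (cardsD1 y (N :\ x)) yN.
have [||f fP] := IH (N :\ x :\ y).
- by move: ltNn; rewrite cN ltnS => /ltnW.
- by move: evN; rewrite cN /= negbK.
have /setD1P[yx yN'] := yN.
exists (fun z => if z == x then y else if z == y then x else f z) => z zN.
have [->|zx] := eqVneq z x; first by rewrite (negbTE yx) eqxx.
have [->|zy] := eqVneq z y; first by rewrite eqxx eq_sym.
have zN' : z \in N :\ x :\ y by rewrite !inE zx zy.
have [/setD1P[fy /setD1P[fx fN]] fK ff] := fP z zN'.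
by rewrite (negbTE fx) (negbTE fy).
Qed.

(** [A] and [N :\: A] are paired separately, so that any colouring alternating along the pairing
    halves both [N] and [A]. *)
Lemma even_pairing_on (T : finType) (N A : {set T}) :
  A \subset N -> ~~ odd #|N| -> ~~ odd #|A| ->
  exists f, pairing f N /\ pairing f A.
Proof.
move=> sAN evN evA; have [f fP] := even_pairing evA.
have [|g gP] := @even_pairing _ (N :\: A).
  by rewrite cardsD (setIidPr sAN) oddB ?subset_leq_card // (negbTE evA) addbF.
pose k x := if x \in A then f x else g x.
have kA : pairing k A by move=> x xA; have [fA fK fx] := fP x xA; rewrite /k xA fA.
exists k; split=> // x xN; case xA: (x \in A).
  by have [kxA kK kx] := kA x xA; rewrite (subsetP sAN).
have xD : x \in N :\: A by rewrite inE xA.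
have [gD gK gx] := gP x xD; have /setDP[gN gA] := gD.
by rewrite /k xA (negbTE gA).
Qed.

Lemma card_half (T : finType) (N : {set T}) (f : T -> T) (c : pred T) :
  pairing f N -> {in N, forall x, c (f x) = ~~ c x} ->
  #|[set x in N | c x]|.*2 = #|N|.
Proof.
move=> fP cf; rewrite -addnn.
have E : f @: [set x in N | c x] = [set x in N | ~~ c x].
  apply/setP => y; rewrite inE; apply/imsetP/andP.
    case=> x; rewrite inE => /andP[xN cx] ->.
    by have [-> _ _] := fP x xN; rewrite cf // cx.
  case=> yN cy; have [fyN fK _] := fP y yN.
  by exists (f y); rewrite // inE fyN cf.
rewrite -(cardsID [set x | c x] N); congr (_ + _).
  by apply: eq_card => x; rewrite !inE.
rewrite -(card_in_imset (f := f)) ?E.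
  by apply: eq_card => x; rewrite !inE andbC.
move=> x y; rewrite !inE => /andP[xN _] /andP[yN _] Exy.
by have [_ <- _] := fP x xN; rewrite Exy; have [_ -> _] := fP y yN.
Qed.

Definition outs (T : finType) (r : rel T) x := [set y | r x y].
Definition ins (T : finType) (r : rel T) y := [set x | r x y].

(** Arcs are paired at their common tail and again at their common head; [h] is one class of a
    colouring alternating along both pairings. Pairing inside [A x] and [B x] makes [h] halve these
    sets too. *)
Lemma even_split (T : finType) (o : rel T) (A B : T -> {set T}) :
  (forall x, A x \subset outs o x /\ B x \subset ins o x) ->
  (forall x, ~~ odd #|outs o x| /\ ~~ odd #|ins o x|) ->
  (forall x, ~~ odd #|A x| /\ ~~ odd #|B x|) ->
  exists h : rel T,
    [/\ subrel h o,
        forall x, #|outs h x|.*2 = #|outs o x| /\ #|ins h x|.*2 = #|ins o x|,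
        forall x, #|A x :&: outs h x|.*2 = #|A x| &
        forall x, #|B x :&: ins h x|.*2 = #|B x|].
Proof.
move=> sAB evO evAB.
have /fin_all_exists[f fP] x : exists f, pairing f (outs o x) /\ pairing f (A x).
  by apply: even_pairing_on; [case: (sAB x)|case: (evO x)|case: (evAB x)].
have /fin_all_exists[g gP] x : exists f, pairing f (ins o x) /\ pairing f (B x).
  by apply: even_pairing_on; [case: (sAB x)|case: (evO x)|case: (evAB x)].
have [||c cP] := @pairing_coloring _ [set p | o p.1 p.2]
    (fun p => (p.1, f p.1 p.2)) (fun p => (g p.2 p.1, p.2)).
- move=> [x y]; rewrite inE /= => oxy; have [fO _] := fP x.
  have := fO y; rewrite !inE => /(_ oxy)[fo -> fy].
  by rewrite fo xpair_eqE eqxx.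
- move=> [x y]; rewrite inE /= => oxy; have [gO _] := gP y.
  have := gO x; rewrite !inE => /(_ oxy)[go -> gx].
  by rewrite go xpair_eqE eqxx andbT.
have cf x y : o x y -> c (x, f x y) = ~~ c (x, y).
  by move=> oxy; have [|-> _] := cP (x, y); rewrite ?inE.
have cg x y : o x y -> c (g y x, y) = ~~ c (x, y).
  by move=> oxy; have [|_ ->] := cP (x, y); rewrite ?inE.
exists (fun x y => o x y && c (x, y)); split=> [x y /andP[]// | x | x | x].
- have [fO _] := fP x; have [gO _] := gP x; split.
    rewrite -(card_half (c := fun y => c (x, y)) fO) => [|y]; last first.
      by rewrite inE; apply: cf.
    by congr _.*2; apply: eq_card => y; rewrite !inE.
  rewrite -(card_half (c := fun y => c (y, x)) gO) => [|y]; last first.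
    by rewrite inE; apply: cg.
  by congr _.*2; apply: eq_card => y; rewrite !inE.
- have [_ fA] := fP x; have [/subsetP sA _] := sAB x.
  rewrite -[RHS](card_half (c := fun y => c (x, y)) fA) => [|y /sA]; last first.
    by rewrite inE; apply: cf.
  by congr _.*2; apply: eq_card => y; rewrite !inE; case yA: (y \in A x);
     rewrite //=; have := sA y yA; rewrite inE => ->.
have [_ gB] := gP x; have [_ /subsetP sB] := sAB x.
rewrite -[RHS](card_half (c := fun y => c (y, x)) gB) => [|y /sB]; last first.
  by rewrite inE; apply: cg.
by congr _.*2; apply: eq_card => y; rewrite !inE; case yB: (y \in B x);
   rewrite //=; have := sB y yB; rewrite inE => ->.
Qed.

Definition orientation (T : finType) (e o : rel T) :=
  (forall x y, e x y = o x y || o y x) /\ (forall x y, ~~ (o x y && o y x)).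

(* Colour the darts so that both reversal and a pairing of the darts at each
   vertex change the colour. *)
Lemma even_orientation (T : finType) (e : rel T) (A : T -> {set T}) :
  symmetric e -> irreflexive e ->
  (forall x, A x \subset outs e x) ->
  (forall x, ~~ odd #|outs e x| /\ ~~ odd #|A x|) ->
  exists o : rel T,
    [/\ orientation e o,
        forall x, #|outs o x|.*2 = #|outs e x| /\ #|ins o x|.*2 = #|outs e x| &
        forall x, #|A x :&: outs o x|.*2 = #|A x|].
Proof.
move=> esym eirr sA ev.
have /fin_all_exists[f fP] x : exists f, pairing f (outs e x) /\ pairing f (A x).
  by have [] := ev x; apply: even_pairing_on.
have [||c cP] := @pairing_coloring _ [set p | e p.1 p.2]
    (fun p => (p.1, f p.1 p.2)) (fun p => (p.2, p.1)).
- move=> [x y]; rewrite inE /= => exy; have [fO _] := fP x.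
  have := fO y; rewrite !inE => /(_ exy)[fo -> fy].
  by rewrite fo xpair_eqE eqxx.
- move=> [x y]; rewrite !inE /= esym => eyx; rewrite eyx; split=> //.
  by apply: contraTneq eyx => -[-> _]; rewrite eirr.
have cf x y : e x y -> c (x, f x y) = ~~ c (x, y).
  by move=> exy; have [|-> _] := cP (x, y); rewrite ?inE.
have cs x y : e x y -> c (y, x) = ~~ c (x, y).
  by move=> exy; have [|_ ->] := cP (x, y); rewrite ?inE.
have outE x : #|[set y | e x y && c (x, y)]|.*2 = #|outs e x|.
  have [fO _] := fP x.
  rewrite -(card_half (c := fun y => c (x, y)) fO) => [|y]; last first.
    by rewrite inE; apply: cf.
  by congr _.*2; apply: eq_card => y; rewrite !inE.
exists (fun x y => e x y && c (x, y)); split=> [|x|x].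
- split=> x y; rewrite (esym y x); case exy: (e x y) => //=; rewrite (cs x y exy).
    by rewrite orbN.
  by rewrite andbN.
- split; first exact: outE.
  have inE' : #|ins (fun x y => e x y && c (x, y)) x| +
      #|[set y | e x y && c (x, y)]| = #|outs e x|.
    rewrite addnC -[RHS](cardsID [set y | c (x, y)]); congr (_ + _).
      by apply: eq_card => y; rewrite !inE.
    apply: eq_card => y; rewrite !inE (esym y x) andbC.
    by case exy: (e x y); rewrite ?andbF ?andbT //= cs.
  by have := outE x; lia.
have [_ fA] := fP x; have /subsetP sAx := sA x.
rewrite -[RHS](card_half (c := fun y => c (x, y)) fA) => [|y /sAx]; last first.
  by rewrite inE; apply: cf.
by congr _.*2; apply: eq_card => y; rewrite !inE; case yA: (y \in A x);
   rewrite //=; have := sAx y yA; rewrite inE => ->.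
Qed.

(** * Halving a digraph while avoiding squares *)

Lemma cards2_other (T : finType) (A : {set T}) x :
  #|A| = 2 -> x \in A -> exists2 y, y != x & A = [set x; y].
Proof.
move=> A2 xA; have /eqP/cards1P[y Ay] : #|A :\ x| = 1.
  by move: A2; rewrite (cardsD1 x) xA => -[].
have : y \in A :\ x by rewrite Ay set11.
by case/setD1P=> yx _; exists y; rewrite // -Ay setD1K.
Qed.

Lemma cards2_sub (T : finType) (A B : {set T}) :
  #|A| = 2 -> #|B| = 2 -> A \subset B -> B = A.
Proof. by move=> A2 B2 sAB; apply/esym/eqP; rewrite eqEcard sAB A2 B2. Qed.

Lemma card_set2I (T : finType) (x y : T) (S : {set T}) : x != y ->
  (#|[set x; y] :&: S| == 1) = (x \in S) (+) (y \in S).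
Proof.
move=> xy; have -> : #|[set x; y] :&: S| = (x \in S) + (y \in S).
  rewrite (cardsD1 x) (cardsD1 y) !inE !eqxx /= orbT.
  rewrite (eq_sym y) xy /= (_ : _ :\ y = set0) ?cards0 ?addn0 //.
  apply/setP => z; rewrite !inE; case: eqP => //= _; case: eqP => //=.
by case: (x \in S); case: (y \in S).
Qed.

(** A 4-cycle of the bipartite double cover, with tails [Q.1] and heads [Q.2]. If [h] has out-degree
    2, it amounts to two centres with the same pair of successors. *)
Definition square (T : finType) (h : rel T) (Q : {set T} * {set T}) :=
  [&& #|Q.1| == 2, #|Q.2| == 2 & [forall b in Q.1, forall a in Q.2, h b a]].

Lemma squareP (T : finType) (h : rel T) (Q : {set T} * {set T}) :
  reflect [/\ #|Q.1| = 2, #|Q.2| = 2 & {in Q.1 & Q.2, forall b a, h b a}]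
          (square h Q).
Proof.
apply: (iffP and3P) => -[/eqP Q1 /eqP Q2]; last first.
  by move=> hQ; split=> //; apply/forall_inP => b bQ; apply/forall_inP => a; apply: hQ.
by move=> /forall_inP hQ; split=> // b a bQ; apply/forall_inP/hQ.
Qed.

Definition biregular (T : finType) (h : rel T) k :=
  forall x, #|outs h x| = k /\ #|ins h x| = k.

Section SquareFree.

(** [F] is a maximal packing of squares of [o], so every square of a subrelation of [o] meets a
    member of [F], where it can be destroyed. *)
Variables (T : finType) (o : rel T) (F : {set {set T} * {set T}}).
Hypothesis F_square : {in F, forall Q, square o Q}.
Hypothesis F_disjoint : {in F &, forall Q R : {set T} * {set T}, Q != R ->
  [disjoint Q.1 & R.1] /\ [disjoint Q.2 & R.2]}.
Hypothesis F_meets : forall R, square o R ->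
  exists2 Q, Q \in F & ~~ [disjoint Q.1 & R.1] \/ ~~ [disjoint Q.2 & R.2].

(** The arcs of [h] inside the 4-cycle [Q] form one of its two perfect matchings; [flip] exchanges
    these. *)
Definition alternating (h : rel T) (Q : {set T} * {set T}) :=
  {in Q.1, forall b, #|Q.2 :&: outs h b| = 1} /\
  {in Q.2, forall a, #|Q.1 :&: ins h a| = 1}.

Definition flip (Q : {set T} * {set T}) (h : rel T) : rel T :=
  fun u v => h u v (+) ((u \in Q.1) && (v \in Q.2)).

(** Each tail or head of [Q] trades its one arc in [Q] for the other, which preserves degrees; the
    other members of [F] share no tail and no head with [Q]. *)
Lemma flip_admissible h Q : Q \in F ->
  subrel h o -> biregular h 2 -> {in F, forall R, alternating h R} ->
  [/\ subrel (flip Q h) o, biregular (flip Q h) 2 &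
      {in F, forall R, alternating (flip Q h) R}].
Proof.
move=> QF sho h2 altF; have /squareP[Q12 Q22 oQ] := F_square QF.
have outF b : b \notin Q.1 -> outs (flip Q h) b = outs h b.
  by move=> bQ; apply/setP => a; rewrite !inE /flip (negbTE bQ) addbF.
have inF a : a \notin Q.2 -> ins (flip Q h) a = ins h a.
  by move=> aQ; apply/setP => b; rewrite !inE /flip (negbTE aQ) andbF addbF.
have outQ b : b \in Q.1 -> #|Q.2 :&: outs (flip Q h) b| = 1.
  move=> bQ; have [/(_ b bQ) Eb _] := altF Q QF.
  apply: (@addnI 1); rewrite -{1}Eb -[RHS]Q22 -[RHS](cardsID (outs h b)).
  congr (_ + _); apply: eq_card => a; rewrite !inE /flip bQ andbC /=.
  by case aQ: (a \in Q.2); rewrite ?andbF ?addbT // andbT.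
have inQ a : a \in Q.2 -> #|Q.1 :&: ins (flip Q h) a| = 1.
  move=> aQ; have [_ /(_ a aQ) Ea] := altF Q QF.
  apply: (@addnI 1); rewrite -{1}Ea -[RHS]Q12 -[RHS](cardsID (ins h a)).
  congr (_ + _); apply: eq_card => b; rewrite !inE /flip aQ andbC /=.
  by case bQ: (b \in Q.1); rewrite ?andbF ?addbT // andbT.
split=> [b a|x|R RF].
- rewrite /flip; case: (boolP (_ && _)) => [/andP[bQ aQ] _|_]; first exact: oQ.
  by rewrite addbF; apply: sho.
- have [ox ix] := h2 x; split.
    have [xQ|xQ] := boolP (x \in Q.1); last by rewrite outF.
    have [/(_ x xQ) Ex _] := altF Q QF.
    rewrite -(cardsID Q.2) setIC outQ // -ox -(cardsID Q.2 (outs h x)).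
    rewrite [_ :&: Q.2]setIC Ex; congr (_ + _); apply: eq_card => a.
    by rewrite !inE /flip; case: (a \in Q.2); rewrite //= andbF addbF.
  have [xQ|xQ] := boolP (x \in Q.2); last by rewrite inF.
  have [_ /(_ x xQ) Ex] := altF Q QF.
  rewrite -(cardsID Q.1) setIC inQ // -ix -(cardsID Q.1 (ins h x)).
  rewrite [_ :&: Q.1]setIC Ex; congr (_ + _); apply: eq_card => a.
  by rewrite !inE /flip; case: (a \in Q.1); rewrite //= addbF.
have [->|RQ] := eqVneq R Q; first by split.
have [dR1 dR2] := F_disjoint RF QF RQ; have [alt1 alt2] := altF R RF.
split=> x xR; first by rewrite outF ?alt1 // (disjointFr dR1).
by rewrite inF ?alt2 // (disjointFr dR2).
Qed.

(* If the square [R] of [h] meets [Q], then [Q] has exactly one edge in [R], and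
   flipping [Q] merges [R] with the component of [h] through the other two
   vertices of [Q]. *)
Lemma flip_square h R :
  subrel h o -> biregular h 2 -> {in F, forall R, alternating h R} ->
  square h R ->
  exists2 Q, Q \in F &
    [set S | square (flip Q h) S] \proper [set S | square h S].
Proof.
move=> sho h2 altF sqR; have /squareP[R1 R2 hR] := sqR.
have [|Q QF meet] := @F_meets R.
  by apply/squareP; split=> // b a bR aR; apply/sho/hR.
exists Q => //; have /squareP[Q12 Q22 _] := F_square QF.
have [alt1 alt2] := altF Q QF.
have outR b : b \in R.1 -> outs h b = R.2.
  move=> bR; apply: cards2_sub => //; first by case: (h2 b).
  by apply/subsetP => a aR; rewrite inE hR.
have inR a : a \in R.2 -> ins h a = R.1.
  move=> aR; apply: cards2_sub => //; first by case: (h2 a).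
  by apply/subsetP => b bR; rewrite inE hR.
(* A common tail or head has an arc of [h] inside [Q], and all its arcs of [h] on that side lie in
   [R]; so [Q] and [R] share an arc of [h]. *)
have [b0 [a0 [b0Q a0Q b0R a0R]]] :
    exists b a, [/\ b \in Q.1, a \in Q.2, b \in R.1 & a \in R.2].
  case: meet => /pred0Pn[x] /andP[/= xQ xR].
    have /eqP/cards1P[a Ea] := alt1 x xQ.
    have : a \in Q.2 :&: outs h x by rewrite Ea set11.
    by rewrite outR // inE => /andP[]; exists x, a.
  have /eqP/cards1P[b Eb] := alt2 x xQ.
  have : b \in Q.1 :&: ins h x by rewrite Eb set11.
  by rewrite inR // inE => /andP[]; exists b, x.
have h00 : h b0 a0 by apply: hR.
have [b1 b10 EQ1] := cards2_other Q12 b0Q.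
have [a1 a10 EQ2] := cards2_other Q22 a0Q.
have [x xb0 ER1] := cards2_other R1 b0R.
have [y ya0 ER2] := cards2_other R2 a0R.
have xR : x \in R.1 by rewrite ER1 set22.
have yR : y \in R.2 by rewrite ER2 set22.
have h01 : ~~ h b0 a1.
  have /eqP := alt1 b0 b0Q; rewrite EQ2 card_set2I 1?eq_sym // !inE h00.
  by case: (h b0 a1).
have h10 : ~~ h b1 a0.
  have /eqP := alt2 a0 a0Q; rewrite EQ1 card_set2I 1?eq_sym // !inE h00.
  by case: (h b1 a0).
have h11 : h b1 a1.
  have := alt1 b1; rewrite EQ1 set22 => /(_ isT)/eqP.
  by rewrite EQ2 card_set2I 1?eq_sym // !inE (negbTE h10).
have xQ : x \notin Q.1.
  rewrite EQ1 !inE negb_or xb0; apply: contraNneq h10 => <-; exact: hR.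
have yQ : y \notin Q.2.
  rewrite EQ2 !inE negb_or ya0; apply: contraNneq h01 => <-; exact: hR.
have flipN u v : (u \notin Q.1) || (v \notin Q.2) -> flip Q h u v = h u v.
  by rewrite -negb_and /flip => /negbTE ->; rewrite addbF.
have [_ fl2 _] := flip_admissible QF sho h2 altF.
apply/properP; split; last first.
  exists R; rewrite !inE //; apply/negP => /squareP[_ _ /(_ _ _ b0R a0R)].
  by rewrite /flip h00 b0Q a0Q.
apply/subsetP => S; rewrite !inE => /squareP[S1 S2 hS].
have outS b : b \in S.1 -> outs (flip Q h) b = S.2.
  move=> bS; apply: cards2_sub => //; first by case: (fl2 b).
  by apply/subsetP => a aS; rewrite inE hS.
have inS a : a \in S.2 -> ins (flip Q h) a = S.1.
  move=> aS; apply: cards2_sub => //; first by case: (fl2 a).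
  by apply/subsetP => b bS; rewrite inE hS.
apply/squareP; split=> // b a bS aS; have := hS b a bS aS.
rewrite {1}/flip; case: (boolP (_ && _)) => [/andP[bQ aQ]|_]; last by rewrite addbF.
rewrite addbT => hba; exfalso.
(* The arcs created by the flip are [b0 a1] and [b1 a0]. Either one in [S], followed along the
   surviving arcs of [R], forces [x] and [y] into [S]; then [x a1] or [b1 y] is an arc of [h]
   leading out of or into [R], which is impossible. *)
have [[Eb Ea]|[Eb Ea]] : b = b0 /\ a = a1 \/ b = b1 /\ a = a0.
- move: bQ aQ hba; rewrite EQ1 EQ2 !inE.
  case/pred2P=> ->; case/pred2P=> ->; rewrite ?h00 ?h11 //; tauto.
- subst b a.
  have yS : y \in S.2 by rewrite -(outS b0) // inE flipN ?yQ ?orbT // hR.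
  have xS : x \in S.1 by rewrite -(inS y) // inE flipN ?xQ // hR.
  have := hS x a1 xS aS; rewrite flipN ?xQ // => hxa.
  have : a1 \in outs h x by rewrite inE.
  rewrite outR // ER2 !inE (negbTE a10) /= => /eqP E.
  by move: yQ; rewrite -E aQ.
subst b a.
have xS : x \in S.1 by rewrite -(inS a0) // inE flipN ?xQ // hR.
have yS : y \in S.2 by rewrite -(outS x) // inE flipN ?xQ // hR.
have := hS b1 y bS yS; rewrite flipN ?yQ ?orbT // => hby.
have : b1 \in ins h y by rewrite inE.
rewrite inR // ER1 !inE (negbTE b10) /= => /eqP E.
by move: xQ; rewrite -E bQ.
Qed.

Lemma kill_squares h :
  subrel h o -> biregular h 2 -> {in F, forall R, alternating h R} ->
  exists h' : rel T,
    [/\ subrel h' o, biregular h' 2 & forall S, ~~ square h' S].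
Proof.
have [n] := ubnP #|[set S | square h S]|.
elim: n h => // n IH h ltSn sho h2 altF.
have [R sqR|noR] := pickP (square h); last by exists h; split=> // S; rewrite noR.
have [Q QF ltQ] := flip_square sho h2 altF sqR.
have [sfo f2 altf] := flip_admissible QF sho h2 altF.
by apply: (IH (flip Q h)) => //; apply: leq_trans (proper_card ltQ) _.
Qed.

End SquareFree.

Lemma squarefree_half (T : finType) (o : rel T) : biregular o 4 ->
  exists h : rel T, [/\ subrel h o, biregular h 2 & forall S, ~~ square h S].
Proof.
move=> o4; pose disj (Q R : {set T} * {set T}) :=
  [disjoint Q.1 & R.1] && [disjoint Q.2 & R.2].
pose ok (F : {set {set T} * {set T}}) :=
  [forall Q in F, square o Q && [forall R in F, (Q != R) ==> disj Q R]].
(* [F] is a maximal family of squares of [o] with pairwise disjoint tail pairs and head pairs. *)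
have [|F /maxsetP[/forall_inP okF maxF] _] := @maxset_exists _ ok set0.
  by apply/forall_inP => Q; rewrite inE.
have Fsq : {in F, forall Q, square o Q} by move=> Q /okF/andP[].
have Fdis : {in F &, forall Q R : {set T} * {set T}, Q != R ->
    [disjoint Q.1 & R.1] /\ [disjoint Q.2 & R.2]}.
  by move=> Q R QF RF QR; have /andP[_ /forall_inP/(_ R RF)] := okF Q QF;
     rewrite QR => /andP.
have Fmeets R : square o R ->
    exists2 Q, Q \in F & ~~ [disjoint Q.1 & R.1] \/ ~~ [disjoint Q.2 & R.2].
  move=> sqR; have [/exists_inP[Q QF]|/exists_inPn noQ] :=
    boolP [exists Q in F, ~~ disj Q R].
    by rewrite negb_and => /orP; exists Q.
  have : R \in F.
    rewrite -(maxF (R |: F)) ?setU11 ?subsetU1 //.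
    apply/forall_inP => Q /setU1P[->|QF].
      rewrite sqR; apply/forall_inP => S /setU1P[->|SF]; first by rewrite eqxx.
      apply/implyP => _; have := noQ S SF; rewrite negbK /disj.
      by rewrite !(disjoint_sym S.1) !(disjoint_sym S.2).
    rewrite Fsq //=; apply/forall_inP => S /setU1P[->|SF].
      by apply/implyP => _; have := noQ Q QF; rewrite negbK.
    by apply/implyP => QS; apply/andP; apply: Fdis.
  exists R => //; left; have /squareP[R1 _ _] := sqR.
  by rewrite -setI_eq0 setIid -cards_eq0 R1.
(* The heads of the unique member of [F] with tail [b], if any. Halving these sets, and dually [B],
   makes [h] alternate on every member of [F]. *)
pose A b := if [pick Q in F | b \in Q.1] is Some Q then Q.2 else set0.
pose B a := if [pick Q in F | a \in Q.2] is Some Q then Q.1 else set0.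
have AE Q b : Q \in F -> b \in Q.1 -> A b = Q.2.
  move=> QF bQ; rewrite /A; case: pickP => [R /andP[RF bR]|/(_ Q)]; last by rewrite QF bQ.
  have [->|RQ] := eqVneq R Q => //; have [d _] := Fdis _ _ RF QF RQ.
  by rewrite (disjointFr d) in bQ.
have BE Q a : Q \in F -> a \in Q.2 -> B a = Q.1.
  move=> QF aQ; rewrite /B; case: pickP => [R /andP[RF aR]|/(_ Q)]; last by rewrite QF aQ.
  have [->|RQ] := eqVneq R Q => //; have [_ d] := Fdis _ _ RF QF RQ.
  by rewrite (disjointFr d) in aQ.
have [|||h [sho h2 hA hB]] := @even_split _ o A B.
- move=> x; rewrite /A /B; split; case: pickP => [Q /andP[QF xQ]|_]; rewrite ?sub0set //.
    have /squareP[_ _ oQ] := Fsq Q QF.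
    by apply/subsetP => a aQ; rewrite inE oQ.
  have /squareP[_ _ oQ] := Fsq Q QF.
  by apply/subsetP => b bQ; rewrite inE oQ.
- by move=> x; have [-> ->] := o4 x.
- move=> x; rewrite /A /B; split; case: pickP => [Q /andP[QF xQ]|_]; rewrite ?cards0 //.
    by have /squareP[_ -> _] := Fsq Q QF.
  by have /squareP[-> _ _] := Fsq Q QF.
apply: (kill_squares Fsq Fdis Fmeets sho) => [x|Q QF].
  by have [] := h2 x; have [-> ->] := o4 x; split; lia.
have /squareP[Q1 Q2 _] := Fsq Q QF.
split=> x xQ.
  by apply: double_inj; rewrite -(AE Q x QF xQ) hA (AE Q) // Q2.
by apply: double_inj; rewrite -(BE Q x QF xQ) hB (BE Q) // Q1.
Qed.

(** * Splitting into permutations, and constraints along cycles *)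

Lemma biregular2_perms (T : finType) (h : rel T) : biregular h 2 ->
  exists s1 s2 : T -> T, [/\ injective s1, injective s2,
    forall x, s1 x != s2 x & forall x y, h x y = (y == s1 x) || (y == s2 x)].
Proof.
(* Halving once more leaves in- and out-degree 1 both in [k] and in the rest of [h], so each is the
   graph of a permutation. *)
move=> h2; have [|||k [skh k1 _ _]] := @even_split _ h (fun=> set0) (fun=> set0).
- by move=> x; rewrite !sub0set.
- by move=> x; have [-> ->] := h2 x.
- by move=> x; rewrite cards0.
have kout x : #|outs k x| = 1 by have [] := k1 x; have [-> ->] := h2 x; lia.
have kin x : #|ins k x| = 1 by have [] := k1 x; have [-> ->] := h2 x; lia.
have /fin_all_exists[s1 s1P] x : exists y, outs k x = [set y].
  by apply/cards1P/eqP.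
have ks1 x : k x (s1 x) by have := set11 (s1 x); rewrite -s1P inE.
have /fin_all_exists[s2 s2P] x : exists y, y != s1 x /\ outs h x = [set s1 x; y].
  have sx : s1 x \in outs h x by rewrite inE skh.
  by have [y yx Ey] := cards2_other (h2 x).1 sx; exists y.
have hE x y : h x y = (y == s1 x) || (y == s2 x).
  by have [_ /setP/(_ y)] := s2P x; rewrite !inE.
exists s1, s2; split=> // [x y E|x y E|x].
- have /eqP/cards1P[z Ez] := kin (s1 x).
  have : x \in ins k (s1 x) by rewrite inE.
  have : y \in ins k (s1 x) by rewrite inE E.
  by rewrite Ez !inE => /eqP -> /eqP ->.
- have notk z : ~~ k z (s2 z).
    have [z2 _] := s2P z; apply: contraNN z2 => kz.
    have : s2 z \in outs k z by rewrite inE.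
    by rewrite s1P inE.
  have : #|ins h (s2 x) :\: ins k (s2 x)| = 1.
    rewrite cardsD (setIidPr _) ?(h2 _).2 ?kin //.
    by apply/subsetP => z; rewrite !inE; apply: skh.
  move/eqP/cards1P=> [z Ez].
  have : x \in ins h (s2 x) :\: ins k (s2 x) by rewrite !inE notk hE eqxx orbT.
  have : y \in ins h (s2 x) :\: ins k (s2 x) by rewrite !inE E notk hE eqxx orbT.
  by rewrite Ez !inE => /eqP -> /eqP ->.
by rewrite eq_sym; case: (s2P x).
Qed.

(** On each cycle, a value compatible with everything allowed after it is fixed at a start point
    [w], and the other values are chosen backwards from [w]. The constraint from [w] to [s w], which
    closes the cycle, then holds automatically. *)
Lemma cyclic_csp (T A : finType) (s : T -> T) (S : T -> pred A)
    (K : T -> rel A) :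
  injective s ->
  (forall v a, S (s v) a -> exists2 b, S v b & K v b a) ->
  (forall v, exists w b, [/\ fconnect s v w, S w b &
     forall a, S (s w) a -> K w b a]) ->
  exists x : T -> A, forall v, S v (x v) /\ K v (x v) (x (s v)).
Proof.
move=> sI back /fin_all_exists[w /fin_all_exists[c start]].
(* Going through the root gives all points of a cycle the same start point. *)
pose tgt v := w (froot s v).
have symc := fconnect_sym sI.
have tgts v : tgt (s v) = tgt v.
  by rewrite /tgt -(rootP symc (fconnect1 s v)).
have reach v : exists n, iter n s v == tgt v.
  have [cw _ _] := start (froot s v).
  have /iter_findex <- : fconnect s v (tgt v).
    by apply: connect_trans cw; apply: connect_root.
  by exists (findex s v (tgt v)).
pose k v := ex_minn (reach v).
have k_iter v : iter (k v) s v = tgt v by rewrite /k; case: ex_minnP => n /eqP.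
have k_min v n : iter n s v = tgt v -> k v <= n.
  by rewrite /k => E; case: ex_minnP => m _; apply; apply/eqP.
have kS v n : k v = n.+1 -> k (s v) = n.
  move=> kv; apply/eqP; rewrite eqn_leq k_min; last first.
    by rewrite tgts -k_iter kv iterSr.
  by rewrite -ltnS -kv; apply: k_min; rewrite iterSr k_iter tgts.
pose g v a := odflt a [pick b | S v b && K v b a].
have gP v a : S (s v) a -> S v (g v a) /\ K v (g v a) a.
  move=> /back[b Sb Kb]; rewrite /g; case: pickP => [b' /andP[]//|/(_ b)].
  by rewrite Sb Kb.
(* [X n v] is meant for [n = k v], the number of steps from [v] forward to the start point. *)
pose fix X (n : nat) (v : T) {struct n} : A := if n is m.+1 then g v (X m (s v)) else c (froot s v).
have SX n v : k v = n -> S v (X n v).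
  elim: n v => [|n IH] v kv /=; last by have [] := gP v _ (IH _ (kS _ _ kv)).
  have [_ + _] := start (froot s v).
  by have := k_iter v; rewrite kv /= {1}/tgt => <-.
exists (fun v => X (k v) v) => v; split; first exact: SX.
case kv: (k v) => [|n] /=; last first.
  by rewrite (kS _ _ kv); have [] := gP v _ (SX _ _ (kS _ _ kv)).
(* Here [v] is the start point itself, and the closing constraint remains. *)
have [_ _ Kc] := start (froot s v).
have Ev := k_iter v; rewrite kv /= {1}/tgt in Ev; rewrite -Ev in Kc.
exact/Kc/SX.
Qed.

(** * Choosing the outer edges of the paths *)

Section ForbiddenPairs.

Variables (T : finType) (f : rel T) (s : T -> T).
Hypothesis sI : injective s.
Hypothesis s_neq : forall v, s v != v.
Hypothesis ss_neq : forall v, s (s v) != v.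
Hypothesis f2 : biregular f 2.
Hypothesis f_asym : forall x y, f x y -> ~~ f y x.
Hypothesis f_out : forall v, ~~ (f v (s v) && f v (s (s v))).
Hypothesis f_in : forall v, ~~ (f (s v) v && f (s (s v)) v).

Let t := finv s.
Let st v : s (t v) = v. Proof. exact: f_finv. Qed.
Let ts v : t (s v) = v. Proof. exact: finv_f. Qed.

(** The other successor of [v] when [x] is one; the default is never reached, as [v] has two
    successors. *)
Let co v x := odflt x [pick y | f v y && (y != x)].

Lemma coP v x : f v x -> [/\ f v (co v x), co v x != x, co v (co v x) = x &
  forall y, f v y -> y = x \/ y = co v x].
Proof.
move=> fvx; have vx : x \in outs f v by rewrite inE.
have [y yx Ey] := cards2_other (f2 v).1 vx.
have fE z : f v z = (z == x) || (z == y).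
  by move/setP/(_ z): Ey; rewrite !inE.
have Ex : co v x = y.
  rewrite /co; case: pickP => [z /andP[]|/(_ y)]; rewrite fE ?eqxx ?orbT ?yx //.
  by case/pred2P=> ->; rewrite ?eqxx.
have -> : co v (co v x) = x.
  rewrite Ex /co; case: pickP => [z /andP[]|/(_ x)].
    by rewrite fE => /pred2P[->|->]; rewrite ?eqxx.
  by rewrite fE eqxx eq_sym yx.
by rewrite Ex fE eqxx orbT; split=> // z; rewrite fE => /pred2P.
Qed.

(** The cycles of [s] have length at least 3, so [t v], [v] and [s v] are distinct, while [z] has
    only two predecessors. *)
Lemma no_three_ins v z : f (t v) z -> f v z -> f (s v) z -> False.
Proof.
move=> h1 h2 h3; have [_ i2] := f2 z.
have : [set t v; v; s v] \subset ins f z.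
  by apply/subsetP => y; rewrite !inE => /orP[/pred2P[]|/eqP] ->.
move/subset_leq_card; rewrite i2 -setUA cardsU1 cards2 !inE negb_or.
rewrite (eq_sym v) s_neq -(inj_eq sI) st (eq_sym v) s_neq.
by rewrite -(inj_eq sI) st eq_sym ss_neq.
Qed.

(* [x] is the successor of [v] serving the constraint between [v] and [s v], and
   [co v x] serves the one between [t v] and [v].  [R] keeps the values allowed
   at [v] alone, and [S] those compatible with some value in [R] at both
   neighbours, which already makes it arc consistent. *)
Let R v x := [&& f v x, x != s v & co v x != t v].
Let Rgt v x := [exists y, R (s v) y && (co (s v) y != x)].
Let Lft v x := [exists y, R (t v) y && (co v x != y)].
Let S v x := [&& R v x, Rgt v x & Lft v x].

(** If one order of the two successors of [v] is forbidden, the other is allowed, since [s v] and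
    [t v] differ. *)
Lemma R_ex v : exists x, R v x.
Proof.
have [x] : exists x, x \in outs f v.
  by apply/card_gt0P; rewrite (f2 v).1.
rewrite inE => fx; have [fy yx coy fE] := coP fx.
have tsv : s v != t v by rewrite -(inj_eq sI) st ss_neq.
have [xs|xs] := eqVneq x (s v).
  by exists (co v x); rewrite /R fy coy -{1}xs yx xs tsv.
have [yt|yt] := eqVneq (co v x) (t v); last by exists x; rewrite /R fx xs yt.
have [ys|ys] := eqVneq (co v x) (s v); first by move: tsv; rewrite -ys yt eqxx.
exists (co v x); rewrite /R fy ys coy -yt eq_sym yx //.
Qed.

(** In a conflict, [v] or [s v] can switch. By [f_in], only [co v x = s v] can block [v]; in that
    case [f_out] and asymmetry leave nothing to block [s v]. *)
Lemma R_forced v x y :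
  R v x -> R (s v) y -> co (s v) y = x -> R v (co v x) \/ R (s v) x.
Proof.
case/and3P=> fx xs xt /and3P[fy ys yt] Exy.
have [fcx cx ccx _] := coP fx; have [fcy cy ccy _] := coP fy.
rewrite Exy in fcy ccy *; rewrite /R fcx fcy ccx ccy ts.
have [Ecx|_] := eqVneq (co v x) (s v); last first.
  have [Ex|_] := eqVneq x (t v); last by left.
  by have := f_in x; rewrite Ex !st -Ex fx fcy.
have [Ex|_] := eqVneq x (s (s v)).
  by have := f_out v; rewrite -Ecx fcx Ecx -Ex fx.
have [Ey|_] := eqVneq y v; last by right.
by move: fy; rewrite Ey (negbTE (f_asym _)) // -Ecx.
Qed.

Lemma R_forced_left v z x :
  R (t v) z -> R v x -> co v x = z -> R (t v) (co (t v) z) \/ R v z.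
Proof. by have := @R_forced (t v) z x; rewrite st. Qed.

(** A value in conflict with all of [R] at one neighbour is switched, which [R_forced] permits; a
    conflict at the opposite neighbour would then give some vertex three predecessors. *)
Lemma S_ex v : exists x, S v x.
Proof.
have [x Rx] := R_ex v; have /and3P[fx _ _] := Rx.
have [fcx cx ccx fE] := coP fx.
have [y Ry] := R_ex (s v); have /and3P[fy _ _] := Ry.
have [fcy _ _ _] := coP fy.
have [z Rz] := R_ex (t v); have /and3P[fz _ _] := Rz.
have [gx|/existsPn gx] := boolP (Rgt v x); last first.
  have Ey : co (s v) y = x by have := gx y; rewrite Ry negbK => /eqP.
  have [Rcx|] := R_forced Rx Ry Ey; last first.
    move=> Rsx; have := gx x; rewrite Rsx negbK; rewrite Ey in fcy.
    by have [_ /negbTE ->] := coP fcy.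
  exists (co v x); rewrite /S Rcx /=; apply/andP; split; apply/existsP.
    by exists y; rewrite Ry Ey eq_sym.
  exists z; rewrite Rz ccx; apply/eqP => xz; subst z.
  by apply: (@no_three_ins v x) => //; rewrite -Ey.
have [lx|/existsPn lx] := boolP (Lft v x); first by exists x; rewrite /S Rx gx.
have Ez : co v x = z by have := lx z; rewrite Rz negbK => /eqP.
have [Rcz|Rvz] := R_forced_left Rz Rx Ez.
  have := lx (co (t v) z); rewrite Rcz negbK Ez => /eqP E.
  by have [_ + _ _] := coP fz; rewrite -E eqxx.
exists z; rewrite /S Rvz /=; apply/andP; split; apply/existsP.
  exists y; rewrite Ry; apply/eqP => E.
  by apply: (@no_three_ins v z); rewrite // -?E // E -Ez.
by exists z; rewrite Rz -Ez ccx eq_sym Ez -{1}Ez.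
Qed.

(** A value compatible with [y] but with nothing at [t v] is switched, again without a new conflict
    by [no_three_ins]. *)
Lemma S_back v y : S (s v) y -> exists2 x, S v x & co (s v) y != x.
Proof.
case/and3P=> Ry _ /existsP[x]; rewrite ts => /andP[Rx xy].
have /and3P[fx _ _] := Rx; have /and3P[fy _ _] := Ry.
have [fcx cx ccx fE] := coP fx; have [fcy _ _ _] := coP fy.
have gx : Rgt v x by apply/existsP; exists y; rewrite Ry.
have [lx|/existsPn lx] := boolP (Lft v x); first by exists x; rewrite // /S Rx gx.
have [z Rz] := R_ex (t v); have /and3P[fz _ _] := Rz.
have Ez : co v x = z by have := lx z; rewrite Rz negbK => /eqP.
have [Rcz|Rvz] := R_forced_left Rz Rx Ez.
  have := lx (co (t v) z); rewrite Rcz negbK Ez => /eqP E.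
  by have [_ + _ _] := coP fz; rewrite -E eqxx.
have zy : co (s v) y != z.
  apply/eqP => E; apply: (@no_three_ins v z); rewrite // -?E // E -Ez //.
exists z => //; rewrite /S Rvz /=; apply/andP; split; apply/existsP.
  by exists y; rewrite Ry.
by exists z; rewrite Rz -Ez ccx eq_sym Ez -{1}Ez.
Qed.

(** A point with a single value in [S] will do, by [S_back]. If [v] and [s v] both have two, a
    successor [x] of [v] serves at [v] unless it is also a successor of [s v]; then it serves at
    [s v], since it cannot have a third predecessor [s (s v)]. *)
Lemma S_start v : exists w x, [/\ fconnect s v w, S w x &
  forall y, S (s w) y -> co (s w) y != x].
Proof.
have single w : (exists2 x, S w x & ~~ S w (co w x)) ->
    exists x, S w x /\ forall y, S (s w) y -> co (s w) y != x.
  case=> x Sx Scx; exists x; split=> // y /S_back[z Sz yz].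
  have /and3P[/and3P[fx _ _] _ _] := Sx; have [_ _ _ fE] := coP fx.
  have /and3P[/and3P[fz _ _] _ _] := Sz.
  by case: (fE z fz) => Ez; rewrite -?Ez //; rewrite -Ez Sz in Scx.
have [x Sx] := S_ex v; have [y Sy] := S_ex (s v).
have [Scx|Scx] := boolP (S v (co v x)); last first.
  by have [|z [Sz zP]] := single v; [exists x | exists v, z].
have [Scy|Scy] := boolP (S (s v) (co (s v) y)); last first.
  have [|z [Sz zP]] := single (s v); first by exists y.
  by exists (s v), z; split=> //; apply: fconnect1.
have /and3P[/and3P[fx _ _] _ _] := Sx; have [_ _ _ fE] := coP fx.
have /and3P[/and3P[fy _ _] _ _] := Sy; have [_ _ _ gE] := coP fy.
have Sv z : f v z -> S v z by move=> /fE[] ->.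
have Ssv z : f (s v) z -> S (s v) z by move=> /gE[] ->.
have coN w z : S w z -> f w (co w z).
  by case/and3P=> /and3P[fz _ _] _ _; case: (coP fz).
have [sx|nx] := boolP (f (s v) x).
  exists (s v), x; split=> [||z Sz]; [exact: fconnect1 | exact: Ssv |].
  apply/eqP => E; apply: (@no_three_ins (s v) x); rewrite ?ts //.
  by rewrite -E; apply: coN.
exists v, x; split=> // z Sz; apply/eqP => E.
by move: nx; rewrite -E coN.
Qed.

Lemma avoiding_labels : exists r l : T -> T,
  [/\ forall v y, f v y = (y == r v) || (y == l v), forall v, l v != r v,
      forall v, r v != s v, forall v, l (s v) != v & forall v, l (s v) != r v].
Proof.
have [r rP] := @cyclic_csp _ _ s S (fun v x y => co (s v) y != x) sI S_back S_start.
have rR v : R v (r v) by have [/and3P[]] := rP v.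
have rf v : f v (r v) by case/and3P: (rR v).
exists r, (fun v => co v (r v)); split=> v.
- move=> y; have [fc _ _ fE] := coP (rf v).
  by apply/idP/pred2P => [/fE|[]->].
- by have [] := coP (rf v).
- by case/and3P: (rR v).
- by case/and3P: (rR (s v)); rewrite ts.
by case: (rP v).
Qed.

End ForbiddenPairs.

(** * Assembling the path decomposition *)

Lemma uniq_edge_seq (T : finType) (s : seq T) : uniq s -> uniq (edge_seq s).
Proof.
case: s => // x p; elim: p x => //= y p IH x /andP[xp up].
rewrite IH // andbT; apply: contra xp => xy.
have edge_sub z q : [set x; y] \in pairmap (fun u v => [set u; v]) z q ->
    x \in z :: q.
  elim: q z => //= u q IHq z; rewrite inE => /predU1P[E|/IHq].
    have := set21 x y; rewrite E !inE => /orP[]/eqP ->; rewrite ?eqxx ?orbT //.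
  by rewrite !inE => /predU1P[->|->]; rewrite ?eqxx ?orbT.
exact: edge_sub xy.
Qed.

Lemma set2_inj_asym (T : finType) (g : rel T) x y x' y' :
  (forall u v, g u v -> ~~ g v u) -> g x y -> g x' y' ->
  [set x; y] = [set x'; y'] -> x = x' /\ y = y'.
Proof.
move=> ga gxy gxy' E.
have xy : x != y by apply: contraTneq gxy => <-; apply/negP => h; have := ga _ _ h; rewrite h.
have := set21 x y; have := set22 x y; rewrite E !inE.
case/pred2P=> Ey; case/pred2P=> Ex; subst x y => //; try by rewrite eqxx in xy.
by case/negP: (ga _ _ gxy).
Qed.

Theorem theorem3p3 (T : finType) (e : rel T) :
  simple_graph e -> regular e 8 ->
  exists B : seq (seq T),
    [/\ l_tracking_decomposition e 4 B,
        path_tracking_decomposition e B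
      & balanced B].
Proof.
move=> [esym eirr] e8.
have [x||o [[eo oasym] oreg _]] := @even_orientation _ e (fun=> set0) esym eirr.
- by rewrite sub0set.
- by move=> x; rewrite cards0 [#|_|]e8.
have o4 : biregular o 4.
  by move=> x; have [] := oreg x; rewrite [#|outs e x|]e8; split; lia.
have [h [sho h2 nosq]] := squarefree_half o4.
have [s1 [s2 [s1I s2I s12 hE]]] := biregular2_perms h2.
pose F x y := [&& e x y, ~~ h x y & ~~ h y x].
have oe x y : o x y -> e x y by rewrite eo => ->.
have he x y : h x y -> e x y by move/sho/oe.
have oa x y : o x y -> ~~ o y x by move=> oxy; have := oasym x y; rewrite oxy.
have ha x y : h x y -> ~~ h y x.
  by move=> /sho oxy; apply: contra (oa _ _ oxy) => /sho.
have Fsym : symmetric F by move=> x y; rewrite /F esym [~~ _ && _]andbC.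
have Firr : irreflexive F by move=> x; rewrite /F eirr.
(* Of the four [o]-successors and four [o]-predecessors of [x], [h] uses two each. *)
have F4 x : #|outs F x| = 4.
  rewrite -(cardsID (outs o x)) -[4]/(2 + 2); congr (_ + _).
    apply: (@addIn 2); rewrite -{1}(h2 x).1 -[RHS](o4 x).1 addnC.
    rewrite -[RHS](cardsID (outs h x)); congr (_ + _); apply: eq_card => y.
      by rewrite !inE; case hxy: (h x y); rewrite ?andbF // sho.
    rewrite !inE /F; case oxy: (o x y); rewrite ?andbF // oe // andbT /=.
    case hyx: (h y x); rewrite ?andbF ?andbT //.
    by have := oa _ _ oxy; rewrite sho.
  apply: (@addIn 2); rewrite -{1}(h2 x).2 -[RHS](o4 x).2 addnC.
  rewrite -[RHS](cardsID (ins h x)); congr (_ + _); apply: eq_card => y.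
    by rewrite !inE; case hxy: (h y x); rewrite ?andbF // sho.
  rewrite !inE /F eo; case oxy: (o x y) => /=.
    by have /negbTE -> := oa _ _ oxy; rewrite andbF.
  case oyx: (o y x); rewrite ?andbF //=.
  by rewrite andbC; case hxy: (h x y) => //; rewrite (sho _ _ hxy) in oxy.
(* [s] sends the first successor of each centre to the second. *)
pose s := s2 \o finv s1.
have sI : injective s by apply: inj_comp => //; apply: finv_inj.
have ss1 b : s (s1 b) = s2 b by rewrite /s /= finv_f.
have s_neq v : s v != v by rewrite -(f_finv s1I v) ss1 eq_sym.
have ss_neq v : s (s v) != v.
  (* A 2-cycle of [s] would give centres [b] and [c] with the same successors, hence a square. *)
  rewrite -(f_finv s1I v) ss1; set b := finv s1 v; set c := finv s1 (s2 b).
  have Ec : s1 c = s2 b by rewrite f_finv.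
  rewrite -Ec ss1; apply/eqP => Eb.
  have bc : b != c by apply/eqP => bc; move: Ec; rewrite -bc; apply/eqP.
  have /squareP[] := nosq ([set b; c], [set s1 b; s2 b]).
  split=> /=; rewrite ?cards2 ?bc ?s12 // => x y.
  by rewrite !inE hE => /pred2P[->|->] /pred2P[->|->]; rewrite ?Eb ?Ec eqxx ?orbT.
(* Halving this pair puts exactly one of [s u] and [s (s u)] among the successors of [u], which
   yields both [f_out] and [f_in]. *)
pose A u := if F u (s u) && F u (s (s u)) then [set s u; s (s u)] else set0.
have [|x|f [[Ff fasym] freg fA]] := @even_orientation _ F A Fsym Firr.
- move=> x; rewrite /A; case: ifP => [/andP[F1 F2]|_]; rewrite ?sub0set //.
  by apply/subsetP => y; rewrite !inE => /pred2P[]->.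
- rewrite F4 /A; case: ifP; rewrite ?cards0 // cards2.
  by rewrite (inj_eq sI) eq_sym s_neq.
have f2 : biregular f 2.
  by move=> x; have [] := freg x; rewrite F4; split; lia.
have fF x y : f x y -> F x y by rewrite Ff => ->.
have fa x y : f x y -> ~~ f y x by move=> fxy; have := fasym x y; rewrite fxy.
have fsplit u : F u (s u) -> F u (s (s u)) -> f u (s u) (+) f u (s (s u)).
  move=> F1 F2; have := fA u; rewrite /A F1 F2 cards2.
  have us : s u != s (s u) by rewrite (inj_eq sI) eq_sym.
  rewrite us => E; have := card_set2I (outs f u) us; rewrite !inE => <-.
  by apply/eqP/double_inj; rewrite E.
have [v|v|r [l [fE lr rs ls lsr]]] := avoiding_labels sI s_neq ss_neq f2 fa.
- apply/negP => /andP[f1 f3].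
  by have := fsplit v (fF _ _ f1) (fF _ _ f3); rewrite f1 f3.
- apply/negP => /andP[f1 f3].
  have := fsplit v; rewrite !(Fsym v) !fF // => /(_ isT isT).
  by rewrite (negbTE (fa _ _ f1)) (negbTE (fa _ _ f3)).
(* Each vertex is [s1 b] for one centre and [s2 b] for one centre, so each of its two outgoing
   [f]-arcs is used once. *)
pose tr b := [:: r (s1 b); s1 b; b; s2 b; l (s2 b)].
pose g x y := h x y || f x y.
have hf x y : h x y -> f x y = false.
  by move=> hxy; apply/negP => /fF/and3P[_]; rewrite hxy.
have hf' x y : h x y -> f y x = false.
  by move=> hxy; apply/negP => /fF/and3P[_ _]; rewrite hxy.
have eg x y : e x y = g x y || g y x.
  rewrite /g; case hxy: (h x y); first by rewrite he.
  case hyx: (h y x); first by rewrite esym he ?orbT.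
  by rewrite /= -Ff /F hxy hyx /= andbT.
have ga x y : g x y -> ~~ g y x.
  rewrite /g negb_or => /orP[hxy|fxy]; first by rewrite ha // hf'.
  rewrite fa // andbT; apply/negP => /hf'; by rewrite fxy.
have h1 b : h b (s1 b) by rewrite hE eqxx.
have h3 b : h b (s2 b) by rewrite hE eqxx orbT.
have fr v : f v (r v) by rewrite fE eqxx.
have fl v : f v (l v) by rewrite fE eqxx orbT.
(* The centre of the trail containing the arc from [x] to [y]. *)
pose ctr x y := if h x y then x else if y == r x then finv s1 x else finv s2 x.
have trE b X : X \in edge_set (tr b) <->
    exists x y, [/\ g x y, X = [set x; y] & ctr x y = b].
  rewrite inE /= !inE; split; last first.
    case=> x [y [+ -> <-]]; rewrite /ctr /g; case hxy: (h x y) => /=.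
      move=> _; move: hxy; rewrite hE => /pred2P[]->; rewrite ?eqxx ?orbT //.
      by rewrite [[set x; s1 x]]setUC eqxx orbT.
    rewrite fE; case: (eqVneq y (r x)) => [-> _|_ /= /eqP ->].
      by rewrite f_finv // setUC eqxx.
    by rewrite !f_finv // eqxx !orbT.
  case/or4P=> /eqP ->.
  - exists (s1 b), (r (s1 b)); rewrite /g fr orbT setUC /ctr eqxx finv_f //.
    by case: ifP => // /hf; rewrite fr.
  - by exists b, (s1 b); rewrite /g h1 setUC /ctr h1.
  - by exists b, (s2 b); rewrite /g h3 /ctr h3.
  exists (s2 b), (l (s2 b)); rewrite /g fl orbT /ctr (negbTE (lr _)) finv_f //.
  by case: ifP => // /hf; rewrite fl.
have gneq x y : g x y -> x != y.
  by move=> gxy; apply: contraTneq gxy => <-; rewrite -(orbb (g _ _)) -eg eirr.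
have not_center u b x : f u x -> h b u -> x != b.
  by move=> fux hbu; apply: contraTneq fux => ->; rewrite (hf' _ _ hbu).
have uniq_tr b : uniq (tr b).
  have rb := not_center _ _ _ (fr (s1 b)) (h1 b).
  have lb := not_center _ _ _ (fl (s2 b)) (h3 b).
  have n1 : s1 b != b by rewrite eq_sym gneq // /g h1.
  have n2 : b != s2 b by rewrite gneq // /g h3.
  have n3 : r (s1 b) != s1 b by rewrite eq_sym gneq // /g fr orbT.
  have n4 : s2 b != l (s2 b) by rewrite gneq // /g fl orbT.
  (* With [v = s1 b] and [s v = s2 b], these three inequalities are the conditions from
     [avoiding_labels]. *)
  have n5 : r (s1 b) != s2 b by rewrite -ss1.
  have n6 : s1 b != l (s2 b) by rewrite eq_sym -ss1.
  have n7 : r (s1 b) != l (s2 b) by rewrite eq_sym -ss1.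
  rewrite /= !inE !negb_or n1 n2 n3 n4 n5 n6 n7 rb s12.
  by rewrite eq_sym lb.
have tracking_tr b : is_tracking e (tr b).
  apply/andP; split; last exact: uniq_edge_seq.
  by rewrite /= !eg /g fr fl h1 h3 !orbT.
pose B := [seq tr b | b <- enum T].
have disj b c : b != c -> [disjoint edge_set (tr b) & edge_set (tr c)].
  apply: contraR => /pred0Pn[X /andP[/= /trE[x [y [gxy -> <-]]]]].
  case/trE=> x' [y' [gxy' E <-]].
  by have [-> ->] := set2_inj_asym ga gxy gxy' E.
have enum_pairwise (P : rel (seq T)) :
    (forall b c, b != c -> P (tr b) (tr c)) -> pairwise P B.
  move=> bP; rewrite pairwise_map; have := enum_uniq T; rewrite uniq_pairwise.
  by apply: sub_pairwise => b c; apply: bP.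
have decB : tracking_decomposition e B.
  split.
  - by apply/allP => _ /mapP[b _ ->].
  - apply: enum_pairwise => b c /disj; apply: contraL.
    have Eb : edge_set (rev (tr c)) = edge_set (tr c).
      rewrite /edge_set edge_seq_rev; move: (edge_seq _) => q.
      by apply/setP => X; rewrite !in_set mem_rev.
    rewrite -setI_eq0 => /orP[/eqP ->|/eqP ->]; rewrite ?Eb setIid.
      by apply/set0Pn; exists [set s1 c; c]; rewrite !inE eqxx orbT.
    by apply/set0Pn; exists [set s1 c; c]; rewrite !inE eqxx orbT.
  - exact: enum_pairwise disj.
  rewrite big_map big_enum; apply/setP => X; apply/bigcupP/imsetP.
    case=> b _ /trE[x [y [gxy -> _]]]; exists (x, y) => //.
    by rewrite inE /= eg gxy.
  case=> -[x y]; rewrite inE /= eg => /orP[gxy ->|gyx ->].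
    by exists (ctr x y) => //; apply/trE; exists x, y.
  by exists (ctr y x) => //; apply/trE; exists y, x; rewrite setUC.
(* The ends of [tr b] are [r (s1 b)] and [l (s2 b)]; reindexing along [s1] and [s2] counts [u] once
   per [f]-predecessor. *)
have arcsB u : arcs_towards B u = 2.
  rewrite /arcs_towards count_flatten sumnE 3!big_map big_enum /=.
  under eq_bigr do rewrite addn0.
  rewrite big_split /= -(reindex_inj s1I (P := xpredT) (F := fun v => (r v == u) : nat)).
  rewrite -(reindex_inj s2I (P := xpredT) (F := fun v => (l v == u) : nat)).
  rewrite -big_split /= -(f2 u).2 -sum1_card [RHS]big_mkcond. apply: eq_bigr => v _.
  rewrite inE fE !(eq_sym u); case: eqVneq => [Er|_] /=.
    by rewrite -Er (negbTE (lr v)).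
  by case: eqP.
exists B; split.
- by split=> //; apply/allP => _ /mapP[b _ ->].
- by split=> //; apply/allP => _ /mapP[b _ ->]; apply: uniq_tr.
by split=> [|u v]; [apply/allP => _ /mapP[b _ ->] | rewrite !arcsB].
Qed.
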